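(* Let $D\subset\mathbb{C}^n$ be invariant with respect to complex conjugation. For every $H\in\mathcal{P}(n)$, the set $\mathcal{S}_{c,H}(\Omega_D)$ is a real subalgebra of $(\mathcal{S}(\Omega_D),\odot)$.
   Context: $\mathbb{H}$ is the algebra of quaternions, $\mathbb{S}_{\mathbb{H}}=\{q\in\mathbb{H}: q^2=-1\}$. $n\ge1$; $\mathcal{P}(n)$ is the set of subsets of $\{1,\dots,n\}$. For $K=\{k_1<\dots<k_p\}\in\mathcal{P}(n)$ and quaternions $q_{k_1},\dots,q_{k_p}$, put $q_K=q_{k_1}\cdots q_{k_p}$ ($q_\emptyset=1$), and $[q_K,a]=q_K\,a$ for $a\in\mathbb{H}$. For $z\in\mathbb{C}^n$, $\overline{z}^h$ is $z$ with its $h$-th coordinate conjugated. $D\subset\mathbb{C}^n$ is invariant with respect to complex conjugation if $z\in D\iff\overline{z}^h\in D$ for every $h$. Its circularization is $\Omega_D=\{(\alpha_l+J_l\beta_l)_{l=1}^n: (\alpha_l+i\beta_l)_{l=1}^n\in D,\ J_1,\dots,J_n\in\mathbb{S}_{\mathbb{H}}\}\subset\mathbb{H}^n$. Let $\{e_K\}_{K\in\mathcal{P}(n)}$ be a basis of $\mathbb{R}^{2^n}$. A stem function is $F=\sum_{K}e_KF_K:D\to\mathbb{H}\otimes\mathbb{R}^{2^n}$, $F_K:D\to\mathbb{H}$, with $F_K(\overline{z}^h)=(-1)^{|K\cap\{h\}|}F_K(z)$ for all $K,h,z$. $F$ induces the slice function $f=\mathcal{I}(F):\Omega_D\to\mathbb{H}$,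 $f(x)=\sum_K[J_K,F_K(z)]$ for $x=(\alpha_l+J_l\beta_l)_l$, $z=(\alpha_l+i\beta_l)_l\in D$. $\mathcal{S}(\Omega_D)$ is the set of slice functions; each slice function is induced by a unique stem function. Slice product: for stem functions $F,G$ put $(F\otimes G)(z)=\sum_{H,K\in\mathcal{P}(n)}(-1)^{|H\cap K|}e_{H\Delta K}F_H(z)G_K(z)$ with $H\Delta K=(H\cup K)\setminus(H\cap K)$; this is again a stem function, and $\mathcal{I}(F)\odot\mathcal{I}(G):=\mathcal{I}(F\otimes G)$. For $f\in\mathcal{S}(\Omega_D)$ and $y\in\Omega_D$ let $f^y_h(x)=f(y_1,\dots,y_{h-1},x,y_{h+1},\dots,y_n)$, for those $x\in\mathbb{H}$ with $(y_1,\dots,y_{h-1},x,y_{h+1},\dots,y_n)\in\Omega_D$. $\mathcal{S}_{c,h}(\Omega_D)$ (functions circular w.r.t. $x_h$) is the set of $f\in\mathcal{S}(\Omega_D)$ such that for every $y\in\Omega_D$, $f^y_h$ is constant on $\mathbb{S}_{y_h}=\{\alpha+I\beta: I\in\mathbb{S}_{\mathbb{H}}\}$, where $y_h=\alpha+J\beta$ with $\alpha,\beta\in\mathbb{R}$, $J\in\mathbb{S}_{\mathbb{H}}$. $\mathcal{S}_{c,H}(\Omega_D)=\bigcap_{h\in H}\mathcal{S}_{c,h}(\Omega_D)$ (understood as $\mathcal{S}(\Omega_D)$ if $H=\emptyset$). *)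

(* Defs.v *)
From HB Require Import structures.
From mathcomp Require Import all_boot all_order all_algebra.
From mathcomp Require Import boolp classical_sets functions reals.
From mathcomp Require Import complex.
From mathcomp Require Import ring.

Set Implicit Arguments.
Unset Strict Implicit.
Unset Printing Implicit Defensive.

Import GRing.Theory Num.Theory.
Local Open Scope classical_set_scope.
Local Open Scope ring_scope.

(* [Quat a b c d] is a + b i + c j + d k. *)
Record quaternion (R : Type) : Type := Quat { qa : R; qb : R; qc : R; qd : R }.

Section QuaternionChoice.
Variable R : Type.
Definition tuple_of_quat (q : quaternion R) : R * R * R * R :=
  let: Quat a b c d := q in (a, b, c, d).
Definition quat_of_tuple (t : R * R * R * R) : quaternion R :=
  let: (a, b, c, d) := t in Quat a b c d.
Lemma tuple_of_quatK : cancel tuple_of_quat quat_of_tuple.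
Proof. by case. Qed.
End QuaternionChoice.

HB.instance Definition _ (R : choiceType) := Choice.copy (quaternion R)
  (can_type (@tuple_of_quatK R)).

Section QuaternionAlgebra.
Variable R : comNzRingType.
Implicit Types p q r : quaternion R.

Definition quat_add p q :=
  Quat (qa p + qa q) (qb p + qb q) (qc p + qc q) (qd p + qd q).
Definition quat_opp p := Quat (- qa p) (- qb p) (- qc p) (- qd p).
Definition quat_scale (a : R) p := Quat (a * qa p) (a * qb p) (a * qc p) (a * qd p).
Definition quat_mul p q :=
  Quat (qa p * qa q - qb p * qb q - qc p * qc q - qd p * qd q)
       (qa p * qb q + qb p * qa q + qc p * qd q - qd p * qc q)
       (qa p * qc q - qb p * qd q + qc p * qa q + qd p * qb q)
       (qa p * qd q + qb p * qc q - qc p * qb q + qd p * qa q).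

Fact quat_addA : associative quat_add.
Proof. by move=> p q r; rewrite /quat_add /= !addrA. Qed.
Fact quat_addC : commutative quat_add.
Proof. by move=> p q; congr Quat; rewrite addrC. Qed.
Fact quat_add0 : left_id (Quat 0 0 0 0) quat_add.
Proof. by case=> a b c d; rewrite /quat_add /= !add0r. Qed.
Fact quat_addN : left_inverse (Quat 0 0 0 0) quat_opp quat_add.
Proof. by move=> p; rewrite /quat_add /= !addNr. Qed.
HB.instance Definition _ := GRing.isZmodule.Build (quaternion R)
  quat_addA quat_addC quat_add0 quat_addN.

Fact quat_mulA : associative quat_mul.
Proof. by move=> p q r; congr Quat => /=; ring. Qed.
Fact quat_mul1q : left_id (Quat 1 0 0 0) quat_mul.
Proof. by case=> a b c d; congr Quat => /=; ring. Qed.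
Fact quat_mulq1 : right_id (Quat 1 0 0 0) quat_mul.
Proof. by case=> a b c d; congr Quat => /=; ring. Qed.
Fact quat_mulDl : left_distributive quat_mul quat_add.
Proof. by move=> p q r; congr Quat => /=; ring. Qed.
Fact quat_mulDr : right_distributive quat_mul quat_add.
Proof. by move=> p q r; congr Quat => /=; ring. Qed.
Fact quat_1neq0 : Quat 1 0 0 0 != 0 :> quaternion R.
Proof. by apply/eqP => -[/eqP]; rewrite oner_eq0. Qed.
HB.instance Definition _ := GRing.Zmodule_isNzRing.Build (quaternion R)
  quat_mulA quat_mul1q quat_mulq1 quat_mulDl quat_mulDr quat_1neq0.

Fact quat_scaleA a b p : quat_scale a (quat_scale b p) = quat_scale (a * b) p.
Proof. by rewrite /quat_scale /= !mulrA. Qed.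
Fact quat_scale1 : left_id 1 quat_scale.
Proof. by case=> a b c d; rewrite /quat_scale /= !mul1r. Qed.
Fact quat_scaleDr : right_distributive quat_scale +%R.
Proof. by move=> a p q; congr Quat => /=; rewrite mulrDr. Qed.
Fact quat_scaleDl p : {morph quat_scale^~ p : a b / a + b}.
Proof. by move=> a b; congr Quat => /=; rewrite mulrDl. Qed.
HB.instance Definition _ := GRing.Zmodule_isLmodule.Build R (quaternion R)
  quat_scaleA quat_scale1 quat_scaleDr quat_scaleDl.

Fact quat_scaleAl (a : R) p q : a *: (p * q) = (a *: p) * q.
Proof. by congr Quat => /=; ring. Qed.
HB.instance Definition _ :=
  GRing.Lmodule_isLalgebra.Build R (quaternion R) quat_scaleAl.

Fact quat_scaleAr (a : R) p q : a *: (p * q) = p * (a *: q).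
Proof. by congr Quat => /=; ring. Qed.
HB.instance Definition _ :=
  GRing.Lalgebra_isAlgebra.Build R (quaternion R) quat_scaleAr.

Definition imaginary_units : set (quaternion R) := [set q | q ^+ 2 = - 1].

End QuaternionAlgebra.

Section Slice.
Variables (R : realType) (n : nat).
Local Notation HH := (quaternion R).
Local Notation CC := R[i].
Local Notation SH := (@imaginary_units R).
Implicit Types (D : set 'rV[CC]_n) (z : 'rV[CC]_n) (J : 'I_n -> HH).

Definition conj_coord (h : 'I_n) z : 'rV[CC]_n :=
  \row_l (if l == h then conjc (z ord0 l) else z ord0 l).

Definition conj_invariant D := forall h z, D z <-> D (conj_coord h z).

Definition slice_point J z : 'rV[HH]_n :=
  \row_l ((complex.Re (z ord0 l))%:A + J l * (complex.Im (z ord0 l))%:A).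

Definition circularization D : set 'rV[HH]_n :=
  [set x | exists z J, [/\ D z, forall l, SH (J l) & x = slice_point J z]].

(* H (x) R^(2^n), an element being given by its quaternionic coordinates in
   the basis (e_K). *)
Definition stem_alg := {ffun {set 'I_n} -> HH}.

Definition stem_basis (K : {set 'I_n}) (q : HH) : stem_alg :=
  [ffun L => if L == K then q else 0].

Definition setsymd (H K : {set 'I_n}) : {set 'I_n} :=
  (H :|: K) :\: (H :&: K).

Definition stem_alg_mul (a b : stem_alg) : stem_alg :=
  \sum_(H : {set 'I_n}) \sum_(K : {set 'I_n})
    ((- 1 : R) ^+ #|H :&: K|) *: stem_basis (setsymd H K) (a H * b K).

Definition stem_function D (F : D -> stem_alg) :=
  forall (K : {set 'I_n}) (h : 'I_n) (z w : D),
    val w = conj_coord h (val z) ->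
    F w K = (- 1) ^+ #|K :&: [set h]| * F z K.

Definition stem_mul D (F G : D -> stem_alg) : D -> stem_alg :=
  fun z : D => stem_alg_mul (F z) (G z).

(* The product runs through K in increasing order, as [index_enum 'I_n] is
   increasing. *)
Definition prodJ J (K : {set 'I_n}) : HH := \prod_(k in K) J k.

(* f = I(F) *)
Definition induces D (F : D -> stem_alg) (f : circularization D -> HH) :=
  forall (z : D) J (x : circularization D),
    (forall l, SH (J l)) -> val x = slice_point J (val z) ->
    f x = \sum_(K : {set 'I_n}) prodJ J K * F z K.

Definition slice_functions D : set (circularization D -> HH) :=
  [set f | exists2 F, stem_function F & induces F f].

Fact setsymdE (H K : {set 'I_n}) l :
  (l \in setsymd H K) = (l \in H) (+) (l \in K).
Proof. by rewrite !inE; case: (l \in H); case: (l \in K). Qed.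

Fact signr_card (H : {set 'I_n}) :
  (- 1 : R) ^+ #|H| = \prod_l (- 1) ^+ (l \in H).
Proof.
rewrite -prodr_const big_mkcond /=.
by apply: eq_bigr => l _; case: (l \in H).
Qed.

Fact signr_symd (A B L : {set 'I_n}) :
  (- 1 : R) ^+ #|setsymd A B :&: L|
  = (- 1) ^+ #|A :&: L| * (- 1) ^+ #|B :&: L|.
Proof.
rewrite !signr_card -big_split; apply: eq_bigr => l _ /=.
rewrite !finset.in_setI !setsymdE.
by case: (l \in A); case: (l \in B); case: (l \in L);
    rewrite /= ?expr0 ?expr1 ?mulr1 ?mul1r ?mulN1r ?opprK.
Qed.

Fact stem_basisD K p q : stem_basis K (p + q) = stem_basis K p + stem_basis K q.
Proof. by apply/ffunP => L; rewrite !ffunE; case: eqP; rewrite ?addr0. Qed.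

Fact stem_basisZ K a q : stem_basis K (a *: q) = a *: stem_basis K q.
Proof. by apply/ffunP => L; rewrite !ffunE; case: eqP; rewrite ?scaler0. Qed.

Fact stem_alg_mul_linl b a u v :
  stem_alg_mul (a *: u + v) b = a *: stem_alg_mul u b + stem_alg_mul v b.
Proof.
rewrite /stem_alg_mul scaler_sumr -big_split; apply: eq_bigr => H _ /=.
rewrite scaler_sumr -big_split; apply: eq_bigr => K _ /=.
rewrite !ffunE mulrDl -scalerAl stem_basisD stem_basisZ scalerDr.
by rewrite !scalerA mulrC.
Qed.

Fact stem_alg_mul_linr b a u v :
  stem_alg_mul b (a *: u + v) = a *: stem_alg_mul b u + stem_alg_mul b v.
Proof.
rewrite /stem_alg_mul scaler_sumr -big_split; apply: eq_bigr => H _ /=.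
rewrite scaler_sumr -big_split; apply: eq_bigr => K _ /=.
rewrite !ffunE mulrDr -scalerAr stem_basisD stem_basisZ scalerDr.
by rewrite !scalerA mulrC.
Qed.

Fact stem_alg_mul0l b : stem_alg_mul 0 b = 0.
Proof.
have := stem_alg_mul_linl b (-1) 0 0.
by rewrite scaler0 addr0 scaleN1r addNr.
Qed.

Fact stem_alg_mul0r b : stem_alg_mul b 0 = 0.
Proof.
have := stem_alg_mul_linr b (-1) 0 0.
by rewrite scaler0 addr0 scaleN1r addNr.
Qed.

Fact stem_alg_mulDl b u v :
  stem_alg_mul (u + v) b = stem_alg_mul u b + stem_alg_mul v b.
Proof. by have := stem_alg_mul_linl b 1 u v; rewrite !scale1r. Qed.

Fact stem_alg_mulDr b u v :
  stem_alg_mul b (u + v) = stem_alg_mul b u + stem_alg_mul b v.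
Proof. by have := stem_alg_mul_linr b 1 u v; rewrite !scale1r. Qed.

Fact stem_alg_mulZl b a u : stem_alg_mul (a *: u) b = a *: stem_alg_mul u b.
Proof. by rewrite -[a *: u]addr0 stem_alg_mul_linl stem_alg_mul0l addr0. Qed.

Fact stem_alg_mulZr b a u : stem_alg_mul b (a *: u) = a *: stem_alg_mul b u.
Proof. by rewrite -[a *: u]addr0 stem_alg_mul_linr stem_alg_mul0r addr0. Qed.

Fact stem_alg_mul_suml b I r (P : pred I) (F : I -> stem_alg) :
  stem_alg_mul (\sum_(i <- r | P i) F i) b
  = \sum_(i <- r | P i) stem_alg_mul (F i) b.
Proof.
exact: (big_morph (stem_alg_mul^~ b) (stem_alg_mulDl b) (stem_alg_mul0l b)).
Qed.

Fact stem_alg_mul_sumr b I r (P : pred I) (F : I -> stem_alg) :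
  stem_alg_mul b (\sum_(i <- r | P i) F i)
  = \sum_(i <- r | P i) stem_alg_mul b (F i).
Proof.
exact: (big_morph (stem_alg_mul b) (stem_alg_mulDr b) (stem_alg_mul0r b)).
Qed.

Fact stem_basis0 K : stem_basis K 0 = 0.
Proof. by apply/ffunP => L; rewrite !ffunE if_same. Qed.

Fact stem_alg_mul_basis H K p q :
  stem_alg_mul (stem_basis H p) (stem_basis K q) =
  ((- 1 : R) ^+ #|H :&: K|) *: stem_basis (setsymd H K) (p * q).
Proof.
rewrite /stem_alg_mul (bigD1 H) //= [X in _ + X]big1 ?addr0; last first.
  move=> L /negPf LH; rewrite big1 // => M _.
  by rewrite !ffunE LH mul0r stem_basis0 scaler0.
rewrite (bigD1 K) //= [X in _ + X]big1 ?addr0; last first.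
  by move=> L /negPf LK; rewrite !ffunE LK mulr0 stem_basis0 scaler0.
by rewrite !ffunE !eqxx.
Qed.

Fact stem_alg_decomp (u : stem_alg) : u = \sum_K stem_basis K (u K).
Proof.
apply/ffunP => L; rewrite sum_ffunE (bigD1 L) //= big1 ?addr0.
  by rewrite ffunE eqxx.
by move=> K KL; rewrite ffunE eq_sym (negPf KL).
Qed.

Fact stem_alg_mulA : associative stem_alg_mul.
Proof.
move=> u v w.
rewrite (stem_alg_decomp u) (stem_alg_mul_suml (stem_alg_mul v w)).
rewrite (stem_alg_mul_suml v) (stem_alg_mul_suml w); apply: eq_bigr => H _.
rewrite (stem_alg_decomp v) (stem_alg_mul_suml w).
rewrite !(stem_alg_mul_sumr (stem_basis H _)) (stem_alg_mul_suml w).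
apply: eq_bigr => K _; rewrite (stem_alg_decomp w).
rewrite !stem_alg_mul_sumr; apply: eq_bigr => L _.
rewrite !stem_alg_mul_basis stem_alg_mulZl stem_alg_mulZr.
rewrite !stem_alg_mul_basis !scalerA mulrA; congr (_ *: stem_basis _ _).
  rewrite !signr_card -!big_split; apply: eq_bigr => l _ /=.
  rewrite !finset.in_setI !setsymdE.
  by case: (l \in H); case: (l \in K); case: (l \in L);
    rewrite ?expr0 ?expr1 ?mulr1 ?mul1r.
by apply/setP => l; rewrite !setsymdE addbA.
Qed.

Definition stem_alg1 : stem_alg := stem_basis finset.set0 1.

Fact stem_alg_mul1l : left_id stem_alg1 stem_alg_mul.
Proof.
move=> u; rewrite [in LHS](stem_alg_decomp u) stem_alg_mul_sumr.
rewrite [RHS](stem_alg_decomp u); apply: eq_bigr => K _.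
rewrite stem_alg_mul_basis finset.set0I cards0 scale1r mul1r; congr stem_basis.
by apply/setP => l; rewrite setsymdE finset.in_set0.
Qed.

Fact stem_alg_mul1r : right_id stem_alg1 stem_alg_mul.
Proof.
move=> u; rewrite [in LHS](stem_alg_decomp u) stem_alg_mul_suml.
rewrite [RHS](stem_alg_decomp u); apply: eq_bigr => K _.
rewrite stem_alg_mul_basis finset.setI0 cards0 scale1r mulr1; congr stem_basis.
by apply/setP => l; rewrite setsymdE finset.in_set0 addbF.
Qed.

Fact signHE k (q : HH) : (- 1) ^+ k * q = ((- 1 : R) ^+ k) *: q.
Proof.
rewrite -signr_odd -[in RHS]signr_odd; case: (odd k).
  by rewrite !expr1 mulN1r scaleN1r.
by rewrite !expr0 mul1r scale1r.
Qed.

Section FixedD.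
Variable D : set 'rV[CC]_n.
Implicit Types F G : D -> stem_alg.

Fact stem_function_lin a F G :
  stem_function F -> stem_function G -> stem_function (a *: F + G).
Proof.
move=> SF SG K h z w wz; rewrite !ffunE (SF _ _ _ _ wz) (SG _ _ _ _ wz).
by rewrite mulrDr scalerAr.
Qed.

Fact stem_function0 : stem_function (0 : D -> stem_alg).
Proof. by move=> K h z w wz; rewrite !ffunE mulr0. Qed.

Fact stem_function1 : stem_function (fun _ : D => stem_alg1).
Proof.
move=> K h z w _; rewrite !ffunE; case: eqP => [->|]; last by rewrite mulr0.
by rewrite finset.set0I cards0 mul1r.
Qed.

Fact stem_function_mul F G :
  stem_function F -> stem_function G -> stem_function (stem_mul F G).
Proof.
move=> SF SG M h z w wz; rewrite /stem_mul /stem_alg_mul !sum_ffunE mulr_sumr.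
apply: eq_bigr => H _; rewrite !sum_ffunE mulr_sumr; apply: eq_bigr => K _.
rewrite !ffunE (SF _ _ _ _ wz) (SG _ _ _ _ wz).
case: eqP => [->|_]; last by rewrite !scaler0 mulr0.
rewrite !signHE -scalerAl -scalerAr !scalerA; congr (_ *: _).
by rewrite signr_symd [RHS]mulrC mulrA.
Qed.

Fact induces_lin a F G f g :
  induces F f -> induces G g -> induces (a *: F + G) (a *: f + g).
Proof.
move=> If Ig z J x SJ xz.
rewrite -[LHS]/(a *: f x + g x) (If z J x) // (Ig z J x) //.
rewrite scaler_sumr -big_split; apply: eq_bigr => K _ /=.
by rewrite !ffunE mulrDr -scalerAr.
Qed.

Fact induces0 : @induces D 0 0.
Proof. by move=> z J x _ _; rewrite big1 // => K _; rewrite ffunE mulr0. Qed.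

Fact slice_functions_lin a f g : slice_functions f -> slice_functions g ->
  slice_functions (a *: f + g : circularization D -> HH).
Proof.
move=> [F SF If] [G SG Ig]; exists (a *: F + G).
  exact: stem_function_lin.
exact: induces_lin.
Qed.

Definition conj_set (T : {set 'I_n}) z : 'rV[CC]_n :=
  \row_l (if l \in T then conjc (z ord0 l) else z ord0 l).

Fact conj_setU1 (h : 'I_n) (T : {set 'I_n}) z : h \notin T ->
  conj_set (h |: T) z = conj_coord h (conj_set T z).
Proof.
move=> hT; apply/rowP => l; rewrite !mxE !inE.
by case: eqP => [->|] //=; rewrite (negPf hT).
Qed.

Fact conj_set0 z : conj_set finset.set0 z = z.
Proof. by apply/rowP => l; rewrite mxE finset.in_set0. Qed.

Hypothesis invD : conj_invariant D.

Fact conj_setD T z : D z -> D (conj_set T z).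
Proof.
have [m] := ubnP #|T|; elim: m T => // m IH T.
have [->|[h hT]] := finset.set_0Vmem T; first by rewrite conj_set0.
rewrite (cardsD1 h) hT add1n ltnS => /IH{}IH Dz.
by rewrite -(finset.setD1K hT) conj_setU1 ?finset.in_setD1 ?eqxx //; apply/(invD _ _).1/IH.
Qed.

Fact stem_conj_set F T (z w : D) K : stem_function F ->
  val w = conj_set T (val z) -> F w K = (- 1) ^+ #|K :&: T| * F z K.
Proof.
move=> SF; have [m] := ubnP #|T|; elim: m T w => // m IH T w.
have [->|[h hT]] := finset.set_0Vmem T.
  by rewrite conj_set0 finset.setI0 cards0 mul1r => _ /val_inj ->.
rewrite (cardsD1 h) hT add1n ltnS => /IH{}IH.
rewrite -{1}(finset.setD1K hT) conj_setU1 ?finset.in_setD1 ?eqxx // => wE.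
have Dv : conj_set (T :\ h) (val z) \in D.
  by apply/mem_set/conj_setD/set_mem/valP.
rewrite (SF K h (SigSub Dv : D) w wE) (IH (SigSub Dv : D)) //.
rewrite mulrA -exprD; congr (_ ^+ _ * _).
rewrite -cardsUI.
have -> : K :&: [set h]%SET :|: K :&: (T :\ h) = K :&: T.
  by rewrite -finset.setIUr finset.setD1K.
have -> : K :&: [set h]%SET :&: (K :&: (T :\ h)) = finset.set0.
  by apply/setP => l; rewrite !inE; case: eqP; rewrite ?andbF.
by rewrite cards0 addn0.
Qed.

Fact imaginary_unitE q : SH q ->
  qa q = 0 /\ qb q * qb q + qc q * qc q + qd q * qd q = 1.
Proof.
case: q => a b c d; rewrite /imaginary_units /= expr2 => -[] /= e1 e2 e3 e4.
have [a0|a0] := eqVneq a 0.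
  split=> //; subst a; apply: oppr_inj; rewrite -e1; ring.
have h (t : R) : a * t + t * a = 0 -> t = 0.
  move=> /eqP; rewrite [t * a]mulrC -mulr2n mulrn_eq0 mulf_eq0 (negPf a0) /=.
  by move/eqP.
have b0 : b = 0 by apply: h; rewrite -[RHS]oppr0 -e2; ring.
have c0 : c = 0 by apply: h; rewrite -[RHS]oppr0 -e3; ring.
have d0 : d = 0 by apply: h; rewrite -[RHS]oppr0 -e4; ring.
have := sqr_ge0 a; rewrite expr2.
have -> : a * a = - 1 by rewrite -e1 b0 c0 d0; ring.
by rewrite oppr_ge0 ler10.
Qed.

Fact prodJ_sign J J' (T K : {set 'I_n}) :
  (forall l, l \in K -> J' l = (- 1) ^+ (l \in T) * J l) ->
  prodJ J' K = (- 1) ^+ #|K :&: T| * prodJ J K.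
Proof.
move=> JJ'; rewrite signHE signr_card /prodJ.
elim: (index_enum _) => [|l s IH]; first by rewrite !big_nil scale1r.
rewrite !big_cons finset.in_setI IH.
case: ifP => lK; last by rewrite expr0 mul1r.
by rewrite JJ' // signHE -scalerAr -scalerAl scalerA mulrC.
Qed.

Fact quat_ext (p q : HH) :
  qa p = qa q -> qb p = qb q -> qc p = qc q -> qd p = qd q -> p = q.
Proof. by case: p; case: q => a b c d a' b' c' d' /= -> -> -> ->. Qed.

Fact quat_pointE (a b a' b' : R) (I I' : HH) : SH I -> SH I' ->
  a%:A + I * b%:A = a'%:A + I' * b'%:A ->
  a = a' /\ ((b' = b /\ (b != 0 -> I' = I)) \/ (b' = - b /\ I' = - I)).
Proof.
move=> /imaginary_unitE[I0 I1] /imaginary_unitE[I'0 I'1].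
rewrite -!scalerAr !mulr1 => E.
have := congr1 (@qa R) E; have := congr1 (@qb R) E.
have := congr1 (@qc R) E; have := congr1 (@qd R) E.
rewrite /= I0 I'0 !mulr0 !addr0 !mulr1 !add0r => Ed Ec Eb Ea.
split=> //.
have : b * b = b' * b'.
  rewrite -[LHS]mulr1 -[RHS]mulr1 -{1}I1 -I'1.
  transitivity ((b * qb I) * (b * qb I) + (b * qc I) * (b * qc I)
    + (b * qd I) * (b * qd I)); first by ring.
  by rewrite Eb Ec Ed; ring.
rewrite -!expr2 => /esym/eqP; rewrite eqf_sqr => /orP[/eqP bb|/eqP bb].
  left; split=> // b0; move: Eb Ec Ed; rewrite bb.
  by do 3![move=> /(mulfI b0) ?]; apply: quat_ext => //; rewrite I0 I'0.
have [b0|b0] := eqVneq b 0.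
  left; split; first by rewrite bb b0 oppr0.
  by rewrite ?b0 ?eqxx.
right; split=> //; move: Eb Ec Ed; rewrite bb !mulNr -!mulrN.
do 3![move=> /(mulfI b0) ?]; apply: quat_ext => /=; rewrite ?I0 ?I'0 ?oppr0 //.
all: by apply/eqP; rewrite -eqr_oppLR; apply/eqP.
Qed.

Fact slice_point_inj J J' z z' :
  (forall l, SH (J l)) -> (forall l, SH (J' l)) ->
  slice_point J z = slice_point J' z' ->
  exists T : {set 'I_n}, z' = conj_set T z /\
    forall l, complex.Im (z ord0 l) != 0 -> J' l = (- 1) ^+ (l \in T) * J l.
Proof.
move=> SJ SJ' E.
exists [set l | complex.Im (z' ord0 l) != complex.Im (z ord0 l)]%SET.
have {}E l : slice_point J z ord0 l = slice_point J' z' ord0 l by rewrite E.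
split.
  apply/rowP => l; rewrite mxE finset.in_set.
  have := E l; rewrite !mxE => /(quat_pointE (SJ l) (SJ' l))[].
  case: (z ord0 l) => a b; case: (z' ord0 l) => a' b' /= -> [[-> _]|[-> _]].
    by rewrite eqxx.
  by case: eqP => //= ->.
move=> l b0; rewrite finset.in_set.
have := E l; rewrite !mxE => /(quat_pointE (SJ l) (SJ' l))[_ [[-> ->//]|]].
  by rewrite eqxx mul1r.
move=> [-> ->]; case: eqP => [h|_]; last by rewrite mulN1r.
by move/eqP: h; rewrite eqNr (negPf b0).
Qed.

Fact quat_eqN (q : HH) : q = - q -> q = 0.
Proof.
move=> h; have : (2 : R) *: q = 0 by rewrite scaler_nat mulr2n {1}h addNr.
move/(congr1 (fun p => 2^-1 *: p)); rewrite scaler0 scalerA mulVf ?scale1r //.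
by rewrite pnatr_eq0.
Qed.

Fact stem_real0 F (z : D) (K : {set 'I_n}) l : stem_function F -> l \in K ->
  complex.Im (val z ord0 l) = 0 -> F z K = 0.
Proof.
move=> SF lK zl; apply: quat_eqN; rewrite {1}(SF K l z z).
  have -> : K :&: [set l]%SET = [set l]%SET.
    by apply/finset.setIidPr; rewrite finset.sub1set.
  by rewrite cards1 mulN1r.
apply/rowP => m; rewrite mxE; case: eqP => // ->.
by case: (val z ord0 l) zl => a b /= ->; rewrite oppr0.
Qed.

Fact induced_wd F (z z' : D) J J' :
  stem_function F -> (forall l, SH (J l)) -> (forall l, SH (J' l)) ->
  slice_point J (val z) = slice_point J' (val z') ->
  \sum_(K : {set 'I_n}) prodJ J K * F z K =
  \sum_(K : {set 'I_n}) prodJ J' K * F z' K.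
Proof.
move=> SF SJ SJ' /(slice_point_inj SJ SJ')[T [zT JT]].
apply: eq_bigr => K _; rewrite (stem_conj_set K SF zT).
have [/existsP[l /andP[lK /eqP zl]]|/existsPn h] :=
    boolP [exists l, (l \in K) && (complex.Im (val z ord0 l) == 0)].
  by rewrite (stem_real0 SF lK zl) !mulr0.
rewrite (@prodJ_sign J J' T K) => [|l lK].
  rewrite !signHE -scalerAl -scalerAr scalerA -exprD addnn -mul2n exprM.
  by rewrite sqrrN expr1n expr1n scale1r.
by apply: JT; have := h l; rewrite lK.
Qed.

(* The slice function I(F); the value does not depend on the chosen z and J
   when F is a stem function. *)
Definition stem_to_slice F : circularization D -> HH := fun x =>
  let: exist z w := cid (set_mem (valP x)) in
  let: exist J (And3 Dz _ _) := cid w in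
  \sum_(K : {set 'I_n}) prodJ J K * F (SigSub (mem_set Dz) : D) K.

Fact stem_to_sliceP F : stem_function F -> induces F (stem_to_slice F).
Proof.
move=> SF z J x SJ xz; rewrite /stem_to_slice.
case: cid => z' w; case: cid => J' [Dz' SJ' xz'].
by apply: induced_wd => //=; rewrite -xz -xz'.
Qed.

Fact induces_fun F f g : induces F f -> induces F g -> f = g.
Proof.
move=> If Ig; apply/funext => x.
have [z [J [Dz SJ xz]]] := set_mem (valP x).
by rewrite (If (SigSub (mem_set Dz) : D) J) // (Ig (SigSub (mem_set Dz) : D) J).
Qed.

Fact sum_signs (K L : {set 'I_n}) : K != L ->
  \sum_(T : {set 'I_n}) (- 1 : R) ^+ #|T :&: L| * (- 1) ^+ #|T :&: K| = 0.
Proof.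
move=> KL; have [l lKL] : exists l, (l \in K) != (l \in L).
  apply/existsP; apply: contraNT KL => /existsPn h.
  by apply/eqP/setP => l; apply/eqP; have := h l; rewrite negbK.
set S := (X in X = 0); suff : S = - S.
  by move/eqP; rewrite -subr_eq0 opprK -mulr2n mulrn_eq0 /= => /eqP.
rewrite /S -sumrN (reindex_inj (h := fun T => setsymd T [set l]%SET)) /=.
  apply: eq_bigr => T _; rewrite !signr_symd mulrACA.
  have c (M : {set 'I_n}) : #|[set l]%SET :&: M| = (l \in M).
    have [lM|lM] := boolP (l \in M).
      by rewrite (finset.setIidPl _) ?cards1 // finset.sub1set.
    apply/eqP; rewrite cards_eq0; apply/eqP/setP => m; rewrite !inE.
    by case: eqP => // ->; rewrite (negPf lM).
  rewrite !c; move: lKL; case: (l \in K); case: (l \in L) => //= _.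
    by rewrite expr0 expr1 mul1r mulrN1.
  by rewrite expr0 expr1 mulr1 mulrN1.
move=> A B AB; apply/setP => m.
have := congr1 (fun X : {set 'I_n} => m \in X) AB.
by rewrite !setsymdE => /addIb.
Qed.

Fact prodJ_inv J K : (forall l, SH (J l)) -> exists q, q * prodJ J K = 1.
Proof.
move=> SJ; rewrite /prodJ; elim: (index_enum _) => [|l s [q IH]].
  by exists 1; rewrite big_nil mulr1.
rewrite big_cons; case: ifP => _; last by exists q.
exists (- (q * J l)); rewrite mulNr -mulrA (mulrA (J l) (J l)) -expr2 (SJ l).
by rewrite mulN1r mulrN opprK.
Qed.

Fact induces_eq0 F : stem_function F -> induces F 0 -> F = 0.
Proof.
move=> SF IF; apply/funext => z; apply/ffunP => L; rewrite [RHS]ffunE.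
pose J (l : 'I_n) : HH := Quat 0 1 0 0.
have SJ l : SH (J l) by apply: quat_ext => /=; ring.
have [q qJ] := prodJ_inv L SJ.
suff : prodJ J L * F z L = 0.
  by move/(congr1 ( *%R q)); rewrite mulrA qJ mul1r mulr0.
have DT T : conj_set T (val z) \in D by apply/mem_set/conj_setD/set_mem/valP.
have H T : \sum_(K : {set 'I_n}) ((- 1 : R) ^+ #|T :&: L| * (- 1) ^+ #|T :&: K|)
    *: (prodJ J K * F z K) = 0.
  have xT : slice_point J (conj_set T (val z)) \in circularization D.
    by apply/mem_set; exists (conj_set T (val z)), J; split=> //; apply/set_mem.
  have := IF (SigSub (DT T) : D) J (SigSub xT : circularization D) SJ erefl.
  rewrite -[LHS]/(0 : HH) => E; rewrite -[RHS](scaler0 _ ((- 1) ^+ #|T :&: L|)).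
  rewrite [in RHS]E scaler_sumr; apply: eq_bigr => K _.
  rewrite (@stem_conj_set F T z (SigSub (DT T) : D) K) // signHE.
  by rewrite -scalerAr scalerA (finset.setIC T K).
have : \sum_(T : {set 'I_n}) \sum_(K : {set 'I_n})
    ((- 1 : R) ^+ #|T :&: L| * (- 1) ^+ #|T :&: K|) *: (prodJ J K * F z K) = 0.
  by rewrite big1.
rewrite exchange_big /= (bigD1 L) //= [X in _ + X]big1 ?addr0; last first.
  by move=> K KL; rewrite -scaler_suml sum_signs // scale0r.
rewrite -scaler_suml => /(congr1 (fun p => (#|{set 'I_n}|%:R^-1 : R) *: p)).
rewrite scaler0 scalerA (eq_bigr (fun=> 1)) => [|T _]; last first.
  by rewrite -expr2 -exprM mulnC exprM sqrrN expr1n expr1n.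
rewrite sumr_const mulVf ?scale1r //.
by rewrite pnatr_eq0 -lt0n; apply/card_gt0P; exists finset.set0.
Qed.

Fact induces_inj F G f : stem_function F -> stem_function G ->
  induces F f -> induces G f -> F = G.
Proof.
move=> SF SG IF IG; apply/eqP; rewrite -subr_eq0; apply/eqP.
rewrite addrC -scaleN1r; apply: induces_eq0; first exact: stem_function_lin.
have -> : 0 = (- 1) *: f + f by rewrite scaleN1r addNr.
exact: induces_lin.
Qed.

End FixedD.

Definition slice_fun D of conj_invariant D : Type := @slice_functions D.

Section SliceAlgebra.
Variables (D : set 'rV[CC]_n) (invD : conj_invariant D).
Local Notation SF := (slice_fun invD).

HB.instance Definition _ := SubChoice.copy SF (@slice_functions D).

Fact slice_functions_submod :
  GRing.subsemimod_closed (mem (@slice_functions D)).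
Proof.
split; last first.
  move=> a f /set_mem Sf; apply/mem_set; rewrite -[a *: f]addr0.
  apply: slice_functions_lin => //; exists 0; [exact: stem_function0|].
  exact: induces0.
split.
  by apply/mem_set; exists 0; [exact: stem_function0|exact: induces0].
move=> f g /set_mem Sf /set_mem Sg; apply/mem_set.
by rewrite -[f]scale1r; exact: slice_functions_lin.
Qed.
HB.instance Definition _ :=
  GRing.SubChoice_isSubLmodule.Build R (circularization D -> HH) _ SF
    slice_functions_submod.

(* The slice function induced by a stem function, as an element of [SF]. *)
Definition slice_of (F : D -> stem_alg) (hF : stem_function F) : SF :=
  SigSub (mem_set (ex_intro2 _ _ F hF (stem_to_sliceP invD hF))).

(* The stem function inducing a slice function (unique by [induces_inj]). *)
Definition stem_of (f : SF) : D -> stem_alg :=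
  projT1 (cid2 (set_mem (valP f))).

Fact stem_ofP (f : SF) : stem_function (stem_of f).
Proof. by rewrite /stem_of; case: cid2. Qed.

Fact stem_of_induces (f : SF) : induces (stem_of f) (val f).
Proof. by rewrite /stem_of; case: cid2. Qed.

Fact stem_ofK (f : SF) : slice_of (stem_ofP f) = f.
Proof.
apply: val_inj; apply: induces_fun (stem_of_induces f).
exact: (stem_to_sliceP invD (stem_ofP f)).
Qed.

Fact slice_ofK F (hF : stem_function F) : stem_of (slice_of hF) = F.
Proof.
apply: (induces_inj invD _ hF (stem_of_induces _)); first exact: stem_ofP.
exact: stem_to_sliceP.
Qed.

Fact stem_of_inj : injective stem_of.
Proof.
move=> f g fg; apply/val_inj/(induces_fun (stem_of_induces f)).
by rewrite fg; exact: stem_of_induces.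
Qed.

Fact stem_of_lin a f g : stem_of (a *: f + g) = a *: stem_of f + stem_of g.
Proof.
apply: (induces_inj invD _ _ (stem_of_induces _)); first exact: stem_ofP.
  by apply: stem_function_lin; exact: stem_ofP.
by apply: induces_lin; exact: stem_of_induces.
Qed.

Fact stem_ofD f g : stem_of (f + g) = stem_of f + stem_of g.
Proof. by rewrite -[f]scale1r stem_of_lin !scale1r. Qed.

Fact stem_of0 : stem_of 0 = 0.
Proof. by apply: (addrI (stem_of 0)); rewrite -stem_ofD !addr0. Qed.

Fact stem_ofZ a f : stem_of (a *: f) = a *: stem_of f.
Proof. by rewrite -[a *: f]addr0 stem_of_lin stem_of0 addr0. Qed.

Definition slice_mul (f g : SF) : SF :=
  slice_of (stem_function_mul (stem_ofP f) (stem_ofP g)).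

Definition slice_one : SF := slice_of (@stem_function1 D).

Fact stem_of_mul f g : stem_of (slice_mul f g) = stem_mul (stem_of f) (stem_of g).
Proof. exact: slice_ofK. Qed.

Fact slice_mulA : associative slice_mul.
Proof.
move=> f g h; apply: stem_of_inj; rewrite !stem_of_mul.
by apply/funext => z; rewrite /stem_mul stem_alg_mulA.
Qed.

Fact slice_mul1f : left_id slice_one slice_mul.
Proof.
move=> f; apply: stem_of_inj; rewrite stem_of_mul slice_ofK.
by apply/funext => z; rewrite /stem_mul stem_alg_mul1l.
Qed.

Fact slice_mulf1 : right_id slice_one slice_mul.
Proof.
move=> f; apply: stem_of_inj; rewrite stem_of_mul slice_ofK.
by apply/funext => z; rewrite /stem_mul stem_alg_mul1r.
Qed.

Fact slice_mulDl : left_distributive slice_mul +%R.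
Proof.
move=> f g h; apply: stem_of_inj; rewrite !(stem_ofD, stem_of_mul).
by apply/funext => z; rewrite /stem_mul stem_alg_mulDl.
Qed.

Fact slice_mulDr : right_distributive slice_mul +%R.
Proof.
move=> f g h; apply: stem_of_inj; rewrite !(stem_ofD, stem_of_mul).
by apply/funext => z; rewrite /stem_mul stem_alg_mulDr.
Qed.

HB.instance Definition _ := GRing.Zmodule_isPzRing.Build SF
  slice_mulA slice_mul1f slice_mulf1 slice_mulDl slice_mulDr.

Fact slice_scaleAl (a : R) (f g : SF) : a *: (f * g) = (a *: f) * g.
Proof.
apply: stem_of_inj; rewrite !(stem_ofZ, stem_of_mul).
by apply/funext => z; rewrite /stem_mul stem_alg_mulZl.
Qed.

Fact slice_scaleAr (a : R) (f g : SF) : a *: (f * g) = f * (a *: g).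
Proof.
apply: stem_of_inj; rewrite !(stem_ofZ, stem_of_mul).
by apply/funext => z; rewrite /stem_mul stem_alg_mulZr.
Qed.

Fact slice_one_val x : val (1 : SF) x = 1.
Proof.
have [z [J [Dz SJ xz]]] := set_mem (valP x).
rewrite (@stem_of_induces (1 : SF) (SigSub (mem_set Dz) : D) J x SJ xz).
rewrite slice_ofK (bigD1 finset.set0) //= [X in _ + X]big1 ?addr0.
  by rewrite ffunE eqxx mulr1 /prodJ big1 // => l; rewrite finset.in_set0.
by move=> K /negPf K0; rewrite ffunE K0 mulr0.
Qed.

Fact slice_mul_induces (f g : SF) F G : stem_function F -> stem_function G ->
  induces F (val f) -> induces G (val g) -> induces (stem_mul F G) (val (f * g)).
Proof.
move=> hF hG If Ig.
rewrite (induces_inj invD hF (stem_ofP f) If (stem_of_induces f)).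
rewrite (induces_inj invD hG (stem_ofP g) Ig (stem_of_induces g)).
by rewrite -stem_of_mul; exact: stem_of_induces.
Qed.

(* Same as [GRing.subalg_closed], which is stated only for a nonzero algebra,
   whereas [SF] is zero when D is empty. *)
Definition real_subalgebra (S : set SF) : Prop :=
  [/\ 1 \in S, GRing.linear_closed (mem S) & GRing.mulr_2closed (mem S)].

(* {a + J b : J in S_H} where q = a + I b *)
Definition sphere (q : HH) : set HH :=
  [set p | exists (a b : R) (I J : HH),
     [/\ SH I, SH J, q = a%:A + I * b%:A & p = a%:A + J * b%:A]].

Definition set_coord (y : 'rV[HH]_n) (h : 'I_n) (q : HH) : 'rV[HH]_n :=
  \row_l (if l == h then q else y ord0 l).

Definition section_dom (y : circularization D) (h : 'I_n) : set HH :=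
  [set q | circularization D (set_coord (val y) h q)].

Definition section_point (y : circularization D) (h : 'I_n)
    (q : section_dom y h) : circularization D :=
  let Oq : circularization D (set_coord (val y) h (val q)) :=
    set_mem (valP q) in
  SigSub (mem_set Oq).

(* f^y_h *)
Definition slice_section (f : SF) (y : circularization D) (h : 'I_n)
    (q : section_dom y h) : HH := val f (section_point q).

Definition circular (h : 'I_n) : set SF :=
  [set f | forall (y : circularization D) (p q : section_dom y h),
     sphere (val y ord0 h) (val p) -> sphere (val y ord0 h) (val q) ->
     slice_section f p = slice_section f q].

(* The intersection is the whole algebra when H is empty. *)
Definition circular_on (H : {set 'I_n}) : set SF :=
  \bigcap_(h in [set` H]) circular h.

End SliceAlgebra.
End Slice.

Arguments conj_invariant {R n} D.
Arguments slice_fun {R n D} invD.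
Arguments real_subalgebra {R n D invD} S.
Arguments circular {R n D} invD h.
Arguments circular_on {R n D} invD H.

(* Main.v *)
Require Import Defs.
From mathcomp Require Import all_boot all_order all_algebra.
From mathcomp Require Import boolp classical_sets functions reals complex.
Local Open Scope ring_scope.

Import GRing.Theory Num.Theory.

(** The defining conditions of circularity quantify over points of the
    circularized domain, where the slice product is not computed pointwise; the
    proof therefore moves them to stem functions.  A slice function is circular
    with respect to x_h if and only if its stem function F is invariant under
    the conjugation of z_h ([circularP]).

    Conjugating z_h replaces x_h = a + J_h b by a - J_h b, which lies on the
    same sphere; so, if f is circular, then F and its composite with the
    conjugation induce the same f, and they coincide because a slice function
    determines its stem function.  Conversely, an invariant F has
    F_K = - F_K = 0 whenever h is in K, so that J_h drops out of
    f(x) = sum_K J_K F_K(z).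

    Since the product of stem functions is computed pointwise in z by the fixed
    product of the algebra H (x) R^(2^n), the invariant stem functions contain
    the constant 1 and are stable under linear combinations and products, and
    the same holds for the intersection over h in H. *)

Section Circular.

Set Implicit Arguments.
Unset Strict Implicit.
Unset Printing Implicit Defensive.
Local Open Scope classical_set_scope.

Variables (R : realType) (n : nat) (D : set 'rV[R[i]]_n).
Variable invD : conj_invariant D.
Local Notation HH := (quaternion R).
Local Notation SH := (@imaginary_units R).
Implicit Types (F : D -> stem_alg R n) (f : slice_fun invD) (h : 'I_n).

Lemma conj_coordC h k (z : 'rV[R[i]]_n) :
  conj_coord h (conj_coord k z) = conj_coord k (conj_coord h z).
Proof. by apply/rowP => l; rewrite !mxE; case: eqP; case: eqP. Qed.

Definition conj_point h (z : D) : D :=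
  SigSub (mem_set ((invD h (val z)).1 (set_mem (valP z)))).

Lemma conj_stem_function F h :
  stem_function F -> stem_function (F \o conj_point h).
Proof. by move=> SF K k z w wz; apply: SF; rewrite /= wz conj_coordC. Qed.

(** Only the sign of b in a + J b is not determined by the point, and it can be
    absorbed in J: the sphere of a point is parametrized by the imaginary units
    in any of the ways of writing this point. *)
Lemma sphere_param (a b : R) (I p : HH) : SH I -> sphere (a%:A + I * b%:A) p ->
  exists2 J, SH J & p = a%:A + J * b%:A.
Proof.
move=> SI [a' [b' [I' [J [SI' SJ E ->]]]]].
have [-> [[-> _]|[-> _]]] := quat_pointE SI SI' E; first by exists J.
exists (- J); first by rewrite /imaginary_units /= sqrrN.
by rewrite scaleNr mulrN mulNr.
Qed.

Lemma sphere_slice_point J (z : 'rV[R[i]]_n) h : (forall l, SH (J l)) ->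
  sphere (slice_point J z ord0 h) (slice_point J (conj_coord h z) ord0 h).
Proof.
move=> SJ; exists (complex.Re (z ord0 h)), (complex.Im (z ord0 h)), (J h), (- J h).
split=> //; [by rewrite /imaginary_units /= sqrrN; exact: SJ|by rewrite mxE|].
rewrite !mxE eqxx; case: (z ord0 h) => a b /=.
by rewrite scaleNr mulrN mulNr.
Qed.

(** Moving x_h to the opposite point of its sphere is conjugating z_h, and this
    single move suffices: invariance under it makes every F_K with h in K odd
    and even at once, and only these terms involve J_h. *)
Lemma circularP f h :
  circular invD h f <-> forall z, stem_of f (conj_point h z) = stem_of f z.
Proof.
split=> [Cf z|inv y p q].
  suff E : stem_of f \o conj_point h = stem_of f by rewrite -[in RHS]E.
  apply: (induces_inj invD _ (stem_ofP f) _ (stem_of_induces f)).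
    exact/conj_stem_function/stem_ofP.
  move=> {}z J x SJ xz; set w := conj_point h z.
  (* x and the point x' obtained by conjugating z_h differ at most in their
     h-th coordinates, which lie on the same sphere. *)
  have xT : slice_point J (val w) \in circularization D.
    by apply/mem_set; exists (val w), J; split=> //; exact/set_mem/valP.
  pose x' : circularization D := SigSub xT.
  rewrite -(stem_of_induces f (x := x') (z := w) SJ erefl).
  have Ex : set_coord (val x) h (val x ord0 h) = val x.
    by apply/rowP => l; rewrite mxE; case: eqP => [->|].
  have Ex' : set_coord (val x) h (val x' ord0 h) = val x'.
    apply/rowP => l; rewrite mxE; case: eqP => [->//|/eqP/negPf lh].
    by rewrite xz !mxE lh.
  have xP : val x ord0 h \in section_dom x h.
    by apply/mem_set; rewrite /section_dom /= Ex; exact/set_mem/valP.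
  have x'P : val x' ord0 h \in section_dom x h.
    by apply/mem_set; rewrite /section_dom /= Ex'; exact/set_mem/valP.
  have := Cf x (SigSub xP) (SigSub x'P).
  rewrite /slice_section.
  have -> : section_point (SigSub xP : section_dom x h) = x by exact: val_inj.
  have -> : section_point (SigSub x'P : section_dom x h) = x' by exact: val_inj.
  apply; rewrite /= xz; last exact: sphere_slice_point.
  rewrite mxE; exists (complex.Re (val z ord0 h)), (complex.Im (val z ord0 h)).
  by exists (J h), (J h).
have [z0 [J [Dz SJ yz]]] := set_mem (valP y).
pose z : D := SigSub (mem_set Dz).
have F0 (K : {set 'I_n}) : h \in K -> stem_of f z K = 0.
  move=> hK; apply: quat_eqN.
  rewrite -{1}inv (stem_ofP f K (h := h) (z := z)) //.
  rewrite (finset.setIidPr _) ?finset.sub1set //.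
  by rewrite cards1 mulN1r.
(* By F0 only the terms free of J_h survive: this is the common value. *)
pose c := \sum_(K : {set 'I_n} | h \notin K) prodJ J K * stem_of f z K.
have E (r : section_dom y h) :
    sphere (val y ord0 h) (val r) -> slice_section f r = c.
  rewrite yz mxE => /(sphere_param (SJ h))[I SI rE].
  pose J' l := if l == h then I else J l.
  have SJ' l : SH (J' l) by rewrite /J'; case: eqP.
  rewrite /slice_section (stem_of_induces f (z := z) SJ'); last first.
    apply/rowP => l; rewrite /J' /= !mxE; case: eqP => [->//|_].
    by rewrite yz mxE.
  rewrite (bigID (fun K : {set 'I_n} => h \in K)) /= big1 ?add0r; last first.
    by move=> K hK; rewrite F0 ?mulr0.
  apply: eq_bigr => K hK; congr (_ * _); apply: eq_bigr => l lK.
  by rewrite /J'; case: eqP lK hK => // -> ->.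
by move=> /E -> /E ->.
Qed.

Lemma circular_subalgebra h : real_subalgebra (circular invD h).
Proof.
split.
- by apply/mem_set/circularP => z; rewrite slice_ofK.
- move=> a f g /set_mem/circularP Cf /set_mem/circularP Cg.
  apply/mem_set/circularP => z; rewrite stem_of_lin.
  by rewrite -[LHS]/(a *: stem_of f _ + stem_of g _) Cf Cg.
- move=> f g /set_mem/circularP Cf /set_mem/circularP Cg.
  apply/mem_set/circularP => z.
  by rewrite stem_of_mul /stem_mul Cf Cg.
Qed.

End Circular.

Theorem corollary3p5 (R : realType) (n : nat) (n_gt0 : (0 < n)%N)
    (D : set 'rV[R[i]]_n) (invD : conj_invariant D) (H : {set 'I_n}) :
  real_subalgebra (circular_on invD H).
Proof.
split.
- by apply/mem_set => h _; have [/set_mem] := circular_subalgebra invD h.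
- move=> a f g /set_mem Cf /set_mem Cg; apply/mem_set => h hH.
  have [_ C _] := circular_subalgebra invD h.
  by apply/set_mem/C; apply/mem_set; [exact: Cf|exact: Cg].
- move=> f g /set_mem Cf /set_mem Cg; apply/mem_set => h hH.
  have [_ _ C] := circular_subalgebra invD h.
  by apply/set_mem/C; apply/mem_set; [exact: Cf|exact: Cg].
Qed.
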